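(* Let $v$ be a prime with $v\equiv 13 \pmod{16}$ and $v=25+4y^2$ for some odd integer $y$. Let $H_4$ be the set of nonzero fourth powers modulo $v$, and in $\mathbb{Z}[\mathbb{Z}_v]$ let $D=P-N$ with $P=H_4$ and $N=\{0\}$. Then $D$ is a signed difference set in $\mathbb{Z}_v$.
   Context: Let $G$ be a finite group of order $v$ and $\mathbb{Z}[G]$ its integral group ring; a subset $S\subseteq G$ is identified with $\sum_{g\in S} g\in\mathbb{Z}[G]$. A $(v,k,\lambda)$ signed difference set in $G$ is an element $D=\sum_{g\in G}s_g g$ with all $s_g\in\{-1,0,1\}$ such that, with $P=\{g:s_g=1\}$, $N=\{g:s_g=-1\}$ and $k=\lvert P\rvert+\lvert N\rvert$, one has $DD^{(-1)}=(k-\lambda)\cdot 1_G+\lambda\sum_{g\in G}g$ for some integer $\lambda$, where $D^{(-1)}=\sum_g s_g g^{-1}$. ''Signed difference set'' means a $(v,k,\lambda)$ signed difference set for some $k,\lambda$. *)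

(* Defs.v *)
From HB Require Import structures.
From mathcomp Require Import all_boot all_order all_algebra all_fingroup.

Set Implicit Arguments.
Unset Strict Implicit.
Unset Printing Implicit Defensive.

Import GRing.Theory.
Local Open Scope ring_scope.

(* The integral group ring Z[gT]: an element is its family of coefficients.
   The alias hides the pointwise product carried by {ffun gT -> int}, so that
   * below is the convolution product. *)
Definition groupRing (gT : finGroupType) : Type := {ffun gT -> int}.

HB.instance Definition _ (gT : finGroupType) :=
  GRing.Zmodule.copy (groupRing gT) {ffun gT -> int}.

Section GroupRing.
Variable gT : finGroupType.
Implicit Types A B C : groupRing gT.

Definition gr_one : groupRing gT := [ffun g => (g == 1%g)%:R].

Definition gr_mul A B : groupRing gT :=
  [ffun g => \sum_(h : gT) A h * B (h^-1 * g)%g].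

Lemma gr_mulA : associative gr_mul.
Proof.
move=> A B C; apply/ffunP=> g; rewrite !ffunE.
under eq_bigr do rewrite ffunE mulr_sumr.
under [RHS]eq_bigr do rewrite ffunE mulr_suml.
rewrite [RHS]exchange_big /=; apply: eq_bigr => h _.
rewrite (reindex_inj (mulgI h^-1%g)) /=; apply: eq_bigr => i _.
by rewrite invMg invgK -mulgA mulKVg mulrA.
Qed.

Lemma gr_mul1 : left_id gr_one gr_mul.
Proof.
move=> A; apply/ffunP=> g; rewrite ffunE (bigD1 1%g) //= big1 => [|h /negPf hN].
  by rewrite ffunE eqxx mul1r addr0 invg1 mul1g.
by rewrite ffunE hN mul0r.
Qed.

Lemma gr_mulr1 : right_id gr_one gr_mul.
Proof.
move=> A; apply/ffunP=> g; rewrite ffunE (bigD1 g) //= big1 => [|h hN].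
  by rewrite ffunE mulVg eqxx mulr1 addr0.
by rewrite ffunE -eq_mulVg1 (negPf hN) mulr0.
Qed.

Lemma gr_mulDl : left_distributive gr_mul +%R.
Proof.
move=> A B C; apply/ffunP=> g; rewrite !ffunE -big_split /=.
by apply: eq_bigr => h _; rewrite ffunE mulrDl.
Qed.

Lemma gr_mulDr : right_distributive gr_mul +%R.
Proof.
move=> A B C; apply/ffunP=> g; rewrite !ffunE -big_split /=.
by apply: eq_bigr => h _; rewrite ffunE mulrDr.
Qed.

Lemma gr_one_neq0 : gr_one != 0.
Proof. by apply/eqP=> /ffunP/(_ 1%g); rewrite !ffunE eqxx. Qed.

HB.instance Definition _ := GRing.Zmodule_isNzRing.Build (groupRing gT)
  gr_mulA gr_mul1 gr_mulr1 gr_mulDl gr_mulDr gr_one_neq0.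

Definition gr_set (S : {set gT}) : groupRing gT := [ffun g => (g \in S)%:R].

(* D^(-1): the coefficient of g in \sum_h D h . h^-1 is D (g^-1). *)
Definition gr_conj (D : groupRing gT) : groupRing gT := [ffun g => D g^-1%g].

Definition gr_pos (D : groupRing gT) : {set gT} := [set g | D g == 1].
Definition gr_neg (D : groupRing gT) : {set gT} := [set g | D g == - 1].

Definition is_sds (v k : nat) (lambda : int) (D : groupRing gT) : Prop :=
  [/\ #|gT| = v,
      forall g, D g \in [:: -1; 0; 1],
      k = (#|gr_pos D| + #|gr_neg D|)%N
    & D * gr_conj D = 1 *~ (k%:Z - lambda) + gr_set [set: gT] *~ lambda].

Definition signed_difference_set (D : groupRing gT) : Prop :=
  exists (k : nat) (lambda : int), is_sds #|gT| k lambda D.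

End GroupRing.

Definition nonzero_fourth_powers (v : nat) : {set 'F_v} :=
  [set x ^+ 4 | x : 'F_v] :\ 0.

(* Main.v *)
(* Let H be the nonzero fourth powers, chi the quadratic character and R(g) the
   number of ways to write g as a difference of two elements of H. Since
   v = 5 (mod 8), -1 is a square but not a fourth power, so every nonzero square
   lies in exactly one of H and -H; hence R is constant on the squares and on the
   nonsquares, and the coefficient of D D^(-1) at g <> 0 is R(g) - [g is a square].
   The claim is thus R(1) - R(n) = 1 for a nonsquare n. Summing chi R gives
   8 (R(1) - R(n)) = J(1) - 2 with J(a) = sum_w chi(w (w^2 - a)), and Jacobsthal's
   identity J(1)^2 + J(n)^2 = 4 v writes v as a sum of two squares, the odd one
   being (J(1)/2)^2. By uniqueness J(1)/2 = 5 or -5, and J(1) = 2 (mod 8) selects 5. *)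
Require Import Defs.
From mathcomp Require Import all_boot all_order all_algebra all_fingroup.
From mathcomp Require Import finfield zify ring.
Set Implicit Arguments.
Unset Strict Implicit.
Unset Printing Implicit Defensive.
Import Order.TTheory GRing.Theory Num.Theory.
Local Open Scope ring_scope.

(** * Uniqueness of the odd square in a sum of two squares equal to a prime *)

Lemma odd_absz_exists (a : int) : odd `|a|%N -> exists k : int, a = 2 * k + 1.
Proof. by exists (a %/ 2)%Z; lia. Qed.

(** Since (ad - bc)(ad + bc) = p(a^2 - c^2), p divides one of the factors. The identity (ad - bc)^2
    + (ac + bd)^2 = p^2 and its variant with -d bound that factor by p in absolute value. If it is
    0, then a^2 = c^2; if it is p or -p, the other square vanishes, which forces p = a^2 + c^2,
    impossible for p odd with a and c odd. *)
Lemma sum_two_squares_uniq (p : nat) (a b c d : int) :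
    prime p -> odd `|a|%N -> odd `|c|%N -> odd p ->
    p%:Z = a ^+ 2 + b ^+ 2 -> p%:Z = c ^+ 2 + d ^+ 2 -> a ^+ 2 = c ^+ 2.
Proof.
move=> p_pr a_odd c_odd p_odd pab pcd; have p_gt0 := prime_gt0 p_pr.
have key : (a * d - b * c) * (a * d + b * c) = p%:Z * (a ^+ 2 - c ^+ 2).
  have -> : p%:Z * (a ^+ 2 - c ^+ 2) = a ^+ 2 * p%:Z - c ^+ 2 * p%:Z by ring.
  by rewrite {1}pcd pab; ring.
(* Taking e = d or e = -d treats both factors at once. *)
have aux (e : int) : e ^+ 2 = d ^+ 2 ->
    (p %| absz (a * e - b * c)%R)%N -> a ^+ 2 = c ^+ 2.
  move=> ed /dvdnP[k abs_k].
  have sqp : (a * e - b * c) ^+ 2 + (a * c + b * e) ^+ 2 = p%:Z ^+ 2.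
    by rewrite [RHS]expr2 {1}pab pcd -ed; ring.
  have sqk : (a * e - b * c) ^+ 2 = k%:Z ^+ 2 * p%:Z ^+ 2.
    suff [->|->] : a * e - b * c = k%:Z * p%:Z \/ a * e - b * c = - (k%:Z * p%:Z).
    - by rewrite exprMn.
    - by rewrite sqrrN exprMn.
    by move: (_ - _) abs_k; clear; lia.
  have fact_ac : (a * e - b * c) * (a * e + b * c) = p%:Z * (a ^+ 2 - c ^+ 2).
    by rewrite -key -[_ * (a * d + b * c)]subr_sqr -subr_sqr !exprMn ed.
  (* The factor is k p up to sign; k > 1 would make its square exceed p^2. *)
  case: k => [|[|k]] in abs_k sqk.
  - have z : a * e - b * c = 0 by apply/eqP; rewrite -absz_eq0 abs_k.
    move/eqP: fact_ac; rewrite z mul0r eq_sym mulf_eq0 eqz_nat -leqn0 leqNgt p_gt0.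
    by rewrite subr_eq0 => /eqP.
  - have /eqP : (a * c + b * e) ^+ 2 = 0.
      by move: sqp; rewrite sqk expr1n mul1r -[RHS]addr0 => /addrI.
    rewrite sqrf_eq0 => /eqP z.
    have ac_p : p%:Z * (p%:Z - a ^+ 2 - c ^+ 2) = 0.
      have -> : p%:Z * (p%:Z - a ^+ 2 - c ^+ 2) =
                (p%:Z - a ^+ 2) * (p%:Z - c ^+ 2) - (a * c) ^+ 2 by ring.
      rewrite [a * c](_ : _ = - (b * e)); last by apply/eqP; rewrite -addr_eq0 z.
      by rewrite {1}pab pcd -ed; ring.
    have [a' aE] := odd_absz_exists a_odd; have [c' cE] := odd_absz_exists c_odd.
    move/eqP: ac_p; rewrite mulf_eq0 eqz_nat -leqn0 leqNgt p_gt0 /=.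
    have -> : p%:Z - a ^+ 2 - c ^+ 2 =
        p%:Z - 2 * (2 * a' * (a' + 1) + 2 * c' * (c' + 1) + 1).
      by rewrite aE cE; ring.
    by move: p_odd (_ + 1); clear=> p_odd r /eqP; lia.
  - have sq_ge0 := sqr_ge0 (a * c + b * e); have p2_gt0 : 0 < p%:Z ^+ 2 by rewrite exprn_gt0.
    have k2_ge : 1 < k.+2%:Z ^+ 2 by rewrite exprn_egt1.
    move: k2_ge; rewrite -(ltr_pMl _ p2_gt0) => /(ltr_wpDr sq_ge0).
    by rewrite -sqk sqp ltxx.
have : (p %| absz ((a * d - b * c) * (a * d + b * c))%R)%N.
  by rewrite key abszM dvdn_mulr.
rewrite abszM Euclid_dvdM // => /orP[|dv]; first exact: aux.
by apply: (aux (- d)); rewrite ?sqrrN // mulrN -opprD abszN.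
Qed.

(** * The quadratic character of a finite field of odd characteristic *)

Section QuadraticCharacter.
Variable F : finFieldType.
Implicit Types (a c n u w x y : F) (G : F -> int).

Definition quadratic_char x : int :=
  if x == 0 then 0 else if [exists y, x == y ^+ 2] then 1 else -1.
Local Notation chi := quadratic_char.

Lemma chi0 : chi 0 = 0. Proof. by rewrite /chi eqxx. Qed.

Lemma chi_sqr x : x != 0 -> chi (x ^+ 2) = 1.
Proof.
move=> x0; rewrite /chi expf_eq0 (negPf x0) andbF.
by case: existsP => // [[]]; exists x.
Qed.

Lemma chi1 : chi 1 = 1. Proof. by rewrite -(expr1n F 2) chi_sqr ?oner_eq0. Qed.

Lemma chi_eq1 x : chi x = 1 -> exists2 y, y != 0 & x = y ^+ 2.
Proof.
rewrite /chi; case: eqP => // /eqP x0; case: existsP => // [[y /eqP xE]] _.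
by exists y => //; apply: contraNneq x0 => y0; rewrite xE y0 expr0n.
Qed.

Lemma chi_eqN1 x : x != 0 -> chi x != 1 -> chi x = -1.
Proof. by rewrite /chi => /negPf->; case: ifP. Qed.

Lemma sum_mull G c : c != 0 -> \sum_x G (c * x) = \sum_x G x.
Proof. by move=> c0; rewrite [RHS](reindex_inj (mulfI c0)). Qed.

Lemma sum_addl G c : \sum_x G (c + x) = \sum_x G x.
Proof. by rewrite [RHS](reindex_inj (addrI c)). Qed.

Lemma sum_nonzero_const (k : int) : \sum_(x : F | x != 0) k = (#|F|%:Z - 1) * k.
Proof.
rewrite sumr_const -mulr_natl natz; congr (_ * _).
have -> : #|(fun x : F => x != 0)| = #|predC1 (0 : F)| by apply: eq_card => x.
by rewrite cardC1 predn_int // ltnW // finNzRing_gt1.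
Qed.

Hypothesis two_neq0 : (2 : F) != 0.

Lemma eqr_opp_eq0 x : (x == - x) = (x == 0).
Proof. by rewrite -addr_eq0 -mulr2n -mulr_natl mulf_eq0 (negPf two_neq0). Qed.

Lemma card_sqrt w : #|[set u | u ^+ 2 == w]|%:Z = 1 + chi w.
Proof.
have [->|w0] := eqVneq w 0.
  rewrite chi0 addr0 -[1]/(1%N%:Z) -(cards1 (0 : F)); congr (Posz #|pred_of_set _|).
  by apply/setP=> u; rewrite !inE expf_eq0.
have [/chi_eq1[c c0 ->]|chiw] := eqVneq (chi w) 1.
  rewrite chi_sqr //.
  have -> : [set u | u ^+ 2 == c ^+ 2] = [set c; - c].
    by apply/setP=> u; rewrite !inE eqf_sqr.
  by rewrite cards2 eqr_opp_eq0 c0.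
rewrite chi_eqN1 // subrr [X in #|pred_of_set X|](_ : _ = set0) ?cards0 //.
apply/setP=> u; rewrite !inE; apply: contraNF chiw => /eqP uw.
by rewrite -uw chi_sqr //; apply: contraNneq w0 => u0; rewrite -uw u0 expr0n.
Qed.

Lemma sum_sqr G : \sum_u G (u ^+ 2) = \sum_w (1 + chi w) * G w.
Proof.
rewrite (partition_big (fun u => u ^+ 2) predT) //=; apply: eq_bigr => w _.
rewrite (eq_bigr (fun=> G w)) => [|u /eqP-> //].
rewrite -card_sqrt sumr_const -mulr_natl natz.
by congr (Posz _ * _); apply: eq_card => u; rewrite !inE.
Qed.

Lemma sum_chi : \sum_w chi w = 0.
Proof.
have := sum_sqr (fun=> 1); under [X in _ = X]eq_bigr do rewrite mulr1.
by rewrite big_split /= -[LHS]addr0 => /addrI.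
Qed.

Lemma chiM_square x y : chi x = 1 -> chi (x * y) = chi y.
Proof.
move=> /chi_eq1[c c0 ->]; rewrite /chi mulf_eq0 expf_eq0 (negPf c0) andbF /=.
case: eqP => // _; congr (if _ then _ else _).
apply/existsP/existsP => [] [u /eqP uE]; last by exists (c * u); rewrite uE exprMn.
exists (u / c); rewrite expr_div_n -uE; apply/eqP.
by rewrite mulrC mulKf // expf_eq0.
Qed.

(* [fun y => - chi (x * y)] dominates [chi] pointwise and both sum to 0. *)
Lemma chiM_nonsquare x y : chi x = -1 -> chi (x * y) = - chi y.
Proof.
move=> chix; have x0 : x != 0 by apply: contra_eq_neq chix => ->; rewrite chi0.
have dom z : 0 <= - chi (x * z) - chi z.
  have [chiz|chiz] := eqVneq (chi z) 1.
    by rewrite mulrC chiM_square // chix chiz.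
  have [->|z0] := eqVneq z 0; first by rewrite mulr0 chi0.
  rewrite (chi_eqN1 z0 chiz).
  by have [->//|/chi_eqN1->//] := eqVneq (chi (x * z)) 1; rewrite mulf_neq0.
have: \sum_z (- chi (x * z) - chi z) = 0.
  by rewrite sumrB sumrN (sum_mull chi) // sum_chi.
move/eqP; rewrite psumr_eq0 // => /allP/(_ y (mem_index_enum _))/eqP/=; lia.
Qed.

Lemma chiM x y : chi (x * y) = chi x * chi y.
Proof.
have [->|x0] := eqVneq x 0; first by rewrite mul0r chi0 mul0r.
have [chix|/(chi_eqN1 x0) chix] := eqVneq (chi x) 1.
  by rewrite chiM_square // chix mul1r.
by rewrite chiM_nonsquare // chix mulN1r.
Qed.

Lemma chi_sqr1 x : x != 0 -> chi x * chi x = 1.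
Proof. by move=> x0; rewrite -chiM -expr2 chi_sqr. Qed.

Lemma exists_nonsquare : exists n, chi n = -1.
Proof.
have [/existsP[n /eqP]|no] := boolP [exists n, chi n == -1]; first by exists n.
have: 0 < \sum_w chi w; last by rewrite sum_chi.
rewrite (bigD1 1) //= chi1 ltr_wpDr // sumr_ge0 // => w _.
rewrite leNgt; apply: contraNN no => chiw; apply/existsP; exists w.
have w0 : w != 0 by apply: contraTneq chiw => ->; rewrite chi0.
by rewrite (chi_eqN1 w0) // lt_eqF // (lt_trans chiw).
Qed.

(** The sums of G(u^2) and G(n u^2) over u weight G(w) by 1 + chi(w) and 1 - chi(w), and these
    weights add up to 2. By invariance each sum is q - 1 copies of a single value, u = 0
    contributing nothing. *)
Lemma sum_square_invariant G n : chi n = -1 -> G 0 = 0 ->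
    (forall a c, c != 0 -> G (a * c ^+ 2) = G a) ->
  2 * \sum_a G a = (#|F|%:Z - 1) * (G 1 + G n).
Proof.
move=> chin G0 Ginv.
have n0 : n != 0 by apply: contra_eq_neq chin => ->; rewrite chi0.
have sqG a : \sum_u G (a * u ^+ 2) = (#|F|%:Z - 1) * G a.
  rewrite (bigD1 0) //= expr0n mulr0 G0 add0r -sum_nonzero_const.
  by apply: eq_bigr => u; exact: Ginv.
rewrite mulrDr -!sqG (sum_sqr (fun w => G (1 * w))) (sum_sqr (fun w => G (n * w))).
have -> : \sum_w (1 + chi w) * G (n * w) = \sum_w (1 - chi w) * G w.
  rewrite [RHS](reindex_inj (mulfI n0)) /=; apply: eq_bigr => w _.
  by rewrite chiM chin mulN1r opprK.
rewrite -big_split mulr_sumr /=; apply: eq_bigr => w _; rewrite mul1r; ring.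
Qed.

(** A translation reduces the summand to chi(a (a + d)) with d = y - x. For d nonzero, the inversion
    a -> d / a turns a (a + d) into a nonzero square times 1 + a, and chi(1 + a) sums to 0 over all
    a, hence to -chi(1) over a nonzero. *)
Lemma sum_chi_quadratic x y :
  \sum_a chi ((x - a) * (y - a)) = if x == y then #|F|%:Z - 1 else -1.
Proof.
have oppI := @oppr_inj F.
have bij : injective (fun a => x - a) by move=> a b /addrI/oppI.
rewrite (reindex_inj bij) /=.
under eq_bigr do rewrite subKr opprB addrCA.
rewrite (bigD1 0) //= mul0r chi0 add0r.
have [->|nxy] := eqVneq x y.
  rewrite -[RHS]mulr1 -sum_nonzero_const; apply: eq_bigr => a a0.
  by rewrite subrr addr0 -expr2 chi_sqr.
have d0 : y - x != 0 by rewrite subr_eq0 eq_sym.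
pose h a := (y - x) / a.
have hK : involutive h by move=> a; rewrite /h invf_div mulrC divfK.
have h0 a : (h a != 0) = (a != 0) by rewrite /h mulf_eq0 (negPf d0) invr_eq0.
rewrite (reindex_inj (inv_inj hK)) /=.
have -> : \sum_(a | h a != 0) chi (h a * (h a + (y - x))) = \sum_(a | a != 0) chi (1 + a).
  apply: eq_big => // a; rewrite h0 => a0.
  have -> : h a * (h a + (y - x)) = h a ^+ 2 * (1 + a) by rewrite /h; field.
  by rewrite chiM chi_sqr ?h0 ?mul1r.
have: \sum_a chi (1 + a) = 0 by rewrite (sum_addl chi) sum_chi.
by rewrite (bigD1 0) //= addr0 chi1 addrC => /eqP; rewrite addr_eq0 => /eqP.
Qed.

(** * Jacobsthal sums and Jacobsthal's identity *)

Definition jacobsthal a : int := \sum_w chi (w * (w ^+ 2 - a)).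

Lemma jacobsthal0 : jacobsthal 0 = 0.
Proof.
rewrite -[RHS]sum_chi; apply: eq_bigr => w _; rewrite subr0.
have [->|w0] := eqVneq w 0; first by rewrite mul0r.
by rewrite chiM chi_sqr ?mulr1.
Qed.

Lemma jacobsthal_sqr a c : c != 0 -> jacobsthal (a * c ^+ 2) = chi c * jacobsthal a.
Proof.
move=> c0; rewrite {1}/jacobsthal (reindex_inj (mulfI c0)) mulr_sumr /=.
apply: eq_bigr => w _.
have -> : c * w * ((c * w) ^+ 2 - a * c ^+ 2) = c ^+ 2 * (c * (w * (w ^+ 2 - a))) by ring.
by rewrite chiM chi_sqr // mul1r chiM.
Qed.

Hypothesis chiN1 : chi (-1) = 1.

Lemma chiN x : chi (- x) = chi x.
Proof. by rewrite -mulN1r chiM chiN1 mul1r. Qed.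

(** J^2 vanishes at 0 and is unchanged when its argument is multiplied by a nonzero square, so
    [sum_square_invariant] reduces the claim to the second moment of J. Expanding J(a)^2 as a double
    sum over x and y and summing over a first leaves a quadratic character sum in a. *)
Lemma jacobsthal_identity n : chi n = -1 ->
  jacobsthal 1 ^+ 2 + jacobsthal n ^+ 2 = 4 * #|F|%:Z.
Proof.
move=> chin; have cardF : #|F|%:Z - 1 != 0.
  by rewrite subr_eq0 eqz_nat gtn_eqF ?finNzRing_gt1.
apply: (mulfI cardF).
rewrite -(@sum_square_invariant (fun a => jacobsthal a ^+ 2) n) //; first last.
- by move=> a c c0; rewrite jacobsthal_sqr // exprMn expr2 chi_sqr1 ?mul1r.
- by rewrite jacobsthal0.
pose q := #|F|%:Z.
have -> : \sum_a jacobsthal a ^+ 2 =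
    \sum_x \sum_y chi (x * y) * (if x ^+ 2 == y ^+ 2 then q - 1 else -1).
  under eq_bigr do rewrite expr2 /jacobsthal big_distrlr /=.
  rewrite exchange_big /=; apply: eq_bigr => x _.
  rewrite exchange_big /=; apply: eq_bigr => y _.
  rewrite -sum_chi_quadratic mulr_sumr; apply: eq_bigr => a _.
  by rewrite !chiM; ring.
have inner x : \sum_y chi (x * y) * (if x ^+ 2 == y ^+ 2 then q - 1 else -1) =
    if x == 0 then 0 else 2 * q.
  have [->|x0] := eqVneq x 0.
    by rewrite big1 // => y _; rewrite mul0r chi0 mul0r.
  (* The constant -1 contributes a full character sum, which is 0; only y = x and y = -x survive,
     each giving q. *)
  have -> : \sum_y chi (x * y) * (if x ^+ 2 == y ^+ 2 then q - 1 else -1) =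
     q * (\sum_(y | x ^+ 2 == y ^+ 2) chi (x * y)) - \sum_y chi (x * y).
    rewrite mulr_sumr [X in _ = X - _]big_mkcond -sumrB /=; apply: eq_bigr => y _.
    by case: ifP => _; ring.
  rewrite (sum_mull chi) // sum_chi subr0 mulrC; congr (_ * _).
  rewrite (bigD1 x) //= (bigD1 (- x)) /=; last first.
    by rewrite sqrrN eqxx eq_sym eqr_opp_eq0 x0.
  rewrite big1 => [|y]; last first.
    by rewrite eq_sym eqf_sqr; case: eqP => //= _; case: eqP.
  by rewrite mulrN chiN -expr2 chi_sqr.
under eq_bigr do rewrite inner.
rewrite (bigD1 0) //= eqxx add0r (eq_bigr (fun=> 2 * q)) => [|x /negPf-> //].
rewrite sum_nonzero_const.
by rewrite -/q; ring.
Qed.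

(** * Nonzero fourth powers when -1 is a square but not a fourth power *)

Definition quartics : {set F} := [set x ^+ 4 | x : F] :\ 0.

Lemma quarticP x : reflect (exists2 u, u != 0 & x = u ^+ 4) (x \in quartics).
Proof.
rewrite !inE; apply: (iffP andP) => [[x0 /imsetP[u _ xE]]|[u u0 ->]].
  by exists u => //; apply: contraNneq x0 => u0; rewrite xE u0 expr0n.
by rewrite expf_eq0 (negPf u0) andbF; split=> //; apply: imset_f.
Qed.

Lemma quarticX4 u : u != 0 -> u ^+ 4 \in quartics.
Proof. by move=> u0; apply/quarticP; exists u. Qed.

Lemma quartic_neq0 x : x \in quartics -> x != 0.
Proof. by rewrite !inE => /andP[]. Qed.

Lemma chi_quartic x : x \in quartics -> chi x = 1.
Proof. by case/quarticP=> u u0 ->; rewrite (exprM u 2 2) chi_sqr // expf_neq0. Qed.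

Lemma quarticMl c x : c \in quartics -> (c * x \in quartics) = (x \in quartics).
Proof.
move=> /quarticP[u u0 ->]; apply/quarticP/quarticP => [] [w w0 wE].
  exists (w / u); first by rewrite mulf_neq0 ?invr_eq0.
  by rewrite expr_div_n -wE mulrC mulKf // expf_neq0.
by exists (u * w); rewrite ?mulf_neq0 // wE exprMn.
Qed.

(** Here q = 4 (2t + 1) + 1, so u^4 = -1 would give u = u^q = -u. *)
Lemma N1_notin_quartics : (#|F| %% 8 = 5)%N -> - 1 \notin quartics.
Proof.
move=> q5; apply/negP=> /quarticP[u u0 uE].
have := expf_card u; rewrite (divn_eq #|F| 8) q5.
have -> : (#|F| %/ 8 * 8 + 5 = (4 * (2 * (#|F| %/ 8) + 1)).+1)%N.
  by move: (#|F| %/ 8)%N; clear; lia.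
rewrite exprS exprM -uE exprD exprM sqrrN !expr1n mul1r expr1 mulrN1 => /esym/eqP.
by rewrite eqr_opp_eq0 (negPf u0).
Qed.

Hypothesis N1_not_quartic : - 1 \notin quartics.

Lemma sqrtN1_nonsquare : exists2 i, i ^+ 2 = -1 & chi i = -1.
Proof.
have [i i0 iE] := chi_eq1 chiN1; exists i => //; apply: chi_eqN1 => //.
apply: contraNneq N1_not_quartic => /chi_eq1[u u0 uE].
by rewrite iE uE -exprM quarticX4.
Qed.

(** If c is a square, c^2 is a fourth power. Otherwise i c is a square, for the nonsquare i with i^2
    = -1, and (i c)^2 = -c^2. *)
Lemma quartic_sqr c : c != 0 -> (c ^+ 2 \in quartics) || (- c ^+ 2 \in quartics).
Proof.
move=> c0; have [i iE chii] := sqrtN1_nonsquare.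
have [/chi_eq1[u u0 ->]|/(chi_eqN1 c0) chic] := eqVneq (chi c) 1.
  by rewrite -exprM quarticX4.
have /chi_eq1[u u0 uE]: chi (i * c) = 1 by rewrite chiM chii chic.
by rewrite -mulN1r -iE -exprMn uE -exprM quarticX4 ?orbT.
Qed.

Lemma quarticN x : x \in quartics -> - x \notin quartics.
Proof. by move=> xH; rewrite -[- x]mulrN1 quarticMl. Qed.

Lemma quartic_or_opp x : x != 0 ->
  (x \in quartics)%:R + (- x \in quartics)%:R = (chi x == 1)%:R :> int.
Proof.
move=> x0; have [/chi_eq1[c c0 ->]|chix] := eqVneq (chi x) 1.
  case/orP: (quartic_sqr c0) => [|h]; last have := quarticN h; rewrite ?opprK.
    by move=> h; rewrite h (negPf (quarticN h)).
  by move=> /negPf->; rewrite h.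
have -> : x \in quartics = false by apply: contraNF chix => /chi_quartic->.
suff -> : - x \in quartics = false by [].
by apply: contraNF chix => /chi_quartic; rewrite chiN => ->.
Qed.

(** The fibre of u -> u^4 through c consists of the four distinct elements c, -c, i c, -i c with i^2
    = -1. *)
Lemma sum_quartic G :
  \sum_(u | u != 0) G (u ^+ 4) = 4 * \sum_(x in quartics) G x.
Proof.
rewrite (partition_big (fun u => u ^+ 4) (mem quartics)) => [|u]; last exact: quarticX4.
rewrite mulr_sumr; apply: eq_bigr => x /quarticP[c c0 ->].
rewrite (eq_bigr (fun=> G (c ^+ 4))) => [|u /andP[_ /eqP-> //]].
rewrite sumr_const mulr_natl; set k := #|_|; suff -> : k = 4%N by [].
have [i iE chii] := sqrtN1_nonsquare.
have i0 : i != 0 by apply: contra_eq_neq chii => ->; rewrite chi0.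
have icE : (i * c) ^+ 2 = - c ^+ 2 by rewrite exprMn iE mulN1r.
have s_uniq : uniq [:: c; - c; i * c; - (i * c)].
  have neq e f : e ^+ 2 = c ^+ 2 -> f ^+ 2 = - c ^+ 2 -> (e == f) = false.
    move=> ec fc; apply/eqP=> ef; move: ec; rewrite ef fc => /esym/eqP.
    by rewrite eqr_opp_eq0 expf_eq0 (negPf c0).
  by rewrite /= !inE !eqr_opp_eq0 mulf_eq0 (negPf i0) (negPf c0) !neq ?sqrrN.
transitivity #|[:: c; - c; i * c; - (i * c)]|; last exact: (card_uniqP s_uniq).
apply: eq_card => u; rewrite !inE [u \in _]unfold_in /=.
rewrite (exprM u 2 2) (exprM c 2 2) eqf_sqr -icE !eqf_sqr -!orbA andb_idl //.
have ic0 : i * c != 0 by rewrite mulf_neq0.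
by case/or4P=> /eqP->; rewrite ?oppr_eq0.
Qed.

(** * The function R counting differences of fourth powers, here [quartic_diff] *)

Definition quartic_diff g : int :=
  \sum_h (h \in quartics)%:R * (h - g \in quartics)%:R.

Lemma quartic_diffN g : quartic_diff (- g) = quartic_diff g.
Proof.
rewrite [RHS](reindex_inj (addrI g)); apply: eq_bigr => h _ /=.
by rewrite opprK mulrC [g + h]addrC addrK.
Qed.

Lemma quartic_diffMl c g : c \in quartics -> quartic_diff (c * g) = quartic_diff g.
Proof.
move=> cH; rewrite /quartic_diff (reindex_inj (mulfI (quartic_neq0 cH))).
by apply: eq_bigr => h _ /=; rewrite -mulrBr !quarticMl.
Qed.

(** One of c^2 and -c^2 is a fourth power, and R is invariant both under multiplication by fourth
    powers and under negation. *)
Lemma quartic_diff_sqr g c : c != 0 -> quartic_diff (g * c ^+ 2) = quartic_diff g.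
Proof.
move=> /quartic_sqr/orP[]h; rewrite mulrC; first exact: quartic_diffMl.
by rewrite -quartic_diffN -mulNr quartic_diffMl.
Qed.

Lemma quartic_diff0 : quartic_diff 0 = #|quartics|%:Z.
Proof.
rewrite -sum1_card -natz natr_sum [RHS]big_mkcond; apply: eq_bigr => h _.
by rewrite subr0; case: (_ \in _).
Qed.

(** Writing g = h - y and then h = y x, with y a fourth power, gives chi(h - y) = chi(x - 1), so the
    inner sum does not depend on y. *)
Lemma sum_chi_quartic_diff :
  \sum_g chi g * quartic_diff g =
  #|quartics|%:Z * \sum_(x in quartics) chi (x - 1).
Proof.
have -> : \sum_g chi g * quartic_diff g =
    \sum_(y in quartics) \sum_h (h \in quartics)%:R * chi (h - y).
  under eq_bigr do rewrite mulr_sumr.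
  rewrite [LHS]exchange_big [RHS]exchange_big /=; apply: eq_bigr => h _.
  have bij : injective (fun y => h - y) by move=> a b /addrI/oppr_inj.
  rewrite [RHS]big_mkcond (reindex_inj bij); apply: eq_bigr => y _ /=.
  by rewrite subKr; case: (y \in _); rewrite ?mulr1 ?mulr0 // mulrC.
rewrite (eq_bigr (fun=> \sum_(x in quartics) chi (x - 1))) => [|y yH].
  by rewrite sumr_const -mulr_natl natz.
rewrite (reindex_inj (mulfI (quartic_neq0 yH))) [RHS]big_mkcond /=.
apply: eq_bigr => h _.
rewrite quarticMl // -{2}[y]mulr1 -mulrBr chiM (chi_quartic yH) mul1r.
by case: (_ \in _); rewrite ?mul1r ?mul0r.
Qed.

(** By [sum_quartic] the left side is the sum of chi(u^4 - 1) over u nonzero. Over all u, grouping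
    by w = u^2 gives the sum of chi(w^2 - 1), which is -1, plus J(1); removing u = 0 subtracts
    chi(-1) = 1. *)
Lemma sum_chi_quartic_sub1 :
  4 * \sum_(x in quartics) chi (x - 1) = jacobsthal 1 - 2.
Proof.
rewrite -(sum_quartic (fun x => chi (x - 1))).
have : \sum_u chi (u ^+ 4 - 1) = -1 + jacobsthal 1.
  have -> : \sum_u chi (u ^+ 4 - 1) = \sum_u chi ((u ^+ 2) ^+ 2 - 1).
    by apply: eq_bigr => u _; rewrite -exprM.
  rewrite (sum_sqr (fun w => chi (w ^+ 2 - 1))).
  (* The factorisation w^2 - 1 = (1 - w)(-1 - w) makes [sum_chi_quadratic] applicable. *)
  have -> : -1 = \sum_a chi ((1 - a) * (-1 - a)).
    by rewrite sum_chi_quadratic eqr_opp_eq0 oner_eq0.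
  rewrite /jacobsthal -big_split; apply: eq_bigr => w _ /=.
  rewrite (chiM w) mulrDl mul1r; congr (chi _ + _); ring.
rewrite (bigD1 0) //= expr0n sub0r chiN1.
by move=> /(canRL (addKr _)) ->; ring.
Qed.

(** With S the sum of chi(x - 1) over H, [sum_square_invariant] applied to chi R gives 2 |H| S = (q
    - 1)(R(1) - R(n)). As q - 1 = 4 |H|, this is S = 2 (R(1) - R(n)), while 4 S = J(1) - 2. *)
Lemma quartic_diff_jacobsthal n : chi n = -1 ->
  8 * (quartic_diff 1 - quartic_diff n) = jacobsthal 1 - 2.
Proof.
move=> chin.
have : 2 * (\sum_g chi g * quartic_diff g) =
    (#|F|%:Z - 1) * (chi 1 * quartic_diff 1 + chi n * quartic_diff n).
  apply: (@sum_square_invariant (fun g => chi g * quartic_diff g)) => // [|a c c0].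
    by rewrite chi0 mul0r.
  by rewrite quartic_diff_sqr // chiM chi_sqr ?mulr1.
rewrite sum_chi_quartic_diff chi1 chin -sum_chi_quartic_sub1.
have := sum_quartic (fun=> 1); rewrite sum_nonzero_const mulr1 => ->.
rewrite sumr_const (natz #|quartics|) mul1r mulN1r.
have H0 : #|quartics|%:Z != 0.
  by rewrite eqz_nat -lt0n; apply/card_gt0P; exists 1; rewrite -(expr1n F 4) quarticX4 ?oner_eq0.
set d := _ - quartic_diff n.
move: (\sum_(x in _) _) d (Posz _) H0 => K d h h0 e; apply: (mulfI h0).
have -> : h * (8 * d) = 2 * (4 * h * d) by ring.
by rewrite -e; ring.
Qed.

Lemma quartic_diff_step n (y : int) : prime #|F| ->
    #|F|%:Z = 5 ^+ 2 + (2 * y) ^+ 2 -> chi n = -1 ->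
  quartic_diff 1 = quartic_diff n + 1.
Proof.
move=> q_pr q_eq chin.
have := jacobsthal_identity chin.
have : jacobsthal 1 = 8 * (quartic_diff 1 - quartic_diff n) + 2.
  by rewrite quartic_diff_jacobsthal // subrK.
set m := quartic_diff 1 - _ => ->.
move: (jacobsthal n) #|F| q_pr q_eq => j q q_pr q_eq q_j.
(* J(n) is even: an odd value would make the left side of Jacobsthal's identity odd. *)
have [T jE] : exists T, j = 2 * T.
  exists (j %/ 2)%Z; have := divz_eq j 2.
  have : (j %% 2 = 0)%Z \/ (j %% 2 = 1)%Z by clear; lia.
  move: (j %/ 2)%Z (j %% 2)%Z => T r [->|->] jE.
    by rewrite jE addr0 mulrC.
  move: q_j; rewrite jE.
  have -> : (8 * m + 2) ^+ 2 + (T * 2 + 1) ^+ 2 =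
      4 * ((4 * m + 1) ^+ 2 + T ^+ 2 + T) + 1 by ring.
  by move: (_ + T) (Posz q); clear; lia.
have q_mT : q%:Z = (4 * m + 1) ^+ 2 + T ^+ 2.
  by apply: (@mulfI _ (4 : int)) => //; rewrite -q_j jE; ring.
have q_odd : odd q.
  move: q_eq; have -> : 5 ^+ 2 + (2 * y) ^+ 2 = 2 * (12 + 2 * y ^+ 2) + 1 by ring.
  by move: (12 + _); clear; lia.
have m_odd : odd (absz (4 * m + 1)%R) by move: (m); clear; lia.
have /eqP := sum_two_squares_uniq q_pr m_odd (isT : odd (absz 5%R)) q_odd q_mT q_eq.
rewrite eqf_sqr => m_eq.
suff m1 : m = 1 by rewrite -m1 addrC subrK.
(* J(1)/2 = 4m + 1 cannot be -5, as 4 does not divide -6. *)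
by case/orP: m_eq => /eqP; move: (m); clear; lia.
Qed.

End QuadraticCharacter.

(** * Coefficients in the group ring and the theorem *)

Lemma gr_mulrzE (gT : finGroupType) (A : groupRing gT) (z : int) (g : gT) :
  (A *~ z) g = A g * z.
Proof.
have mulrnE n : (A *+ n) g = A g * n%:Z.
  elim: n => [|n IHn]; first by rewrite mulr0n ffunE mulr0.
  by rewrite mulrS ffunE IHn intS mulrDr mulr1.
by case: z => n; rewrite ?NegzE ?mulrNz ?ffunE /= -?pmulrn mulrnE ?mulrN.
Qed.

(* The finGroupType structure of 'F_v is its additive group, i.e. Z_v. *)
Theorem theorem6 (v : nat) (v_prime : prime v) (v_mod16 : v = 13 %[mod 16])
    (v_eq : exists y : int, odd `|y|%N /\ v%:Z = 25 + 4 * y ^+ 2) :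
  signed_difference_set
    (gr_set (nonzero_fourth_powers v) - gr_set [set (0 : 'F_v)]).
Proof.
case: v_eq => y [_ v_eq].
have natF_eq0 n : (n%:R == 0 :> 'F_v) = (v %| n)%N.
  by rewrite (dvdn_pcharf (pchar_Fp v_prime)).
have v_gt5 : (5 < v)%N by move: v_mod16 (prime_gt1 v_prime); clear; lia.
have small n : (0 < n <= 5)%N -> (n%:R : 'F_v) != 0.
  by rewrite natF_eq0 => /andP[n0 n5]; rewrite gtnNdvd // (leq_ltn_trans n5).
have two0 := small 2%N isT; have five0 := small 5%N isT.
have tf0 : (25 : 'F_v) != 0 by rewrite -[25%N]/(5 * 5)%N natrM mulf_neq0.
have cardF := card_Fp v_prime.
have chiN1 : quadratic_char (-1 : 'F_v) = 1.
  (* Modulo v, 25 + 4 y^2 = 0, so 2y/5 is a square root of -1. *)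
  pose i : 'F_v := (2 * y%:~R) / 5.
  have iE : i ^+ 2 = -1.
    have : (v%:Z%:~R : 'F_v) = 25 + 4 * y%:~R ^+ 2.
      by rewrite v_eq rmorphD rmorphM rmorphXn.
    rewrite -pmulrn; have /eqP-> : (v%:R == 0 :> 'F_v) by rewrite natF_eq0.
    move=> e; have -> : i ^+ 2 = (25 + 4 * y%:~R ^+ 2) / 25 - 1.
      by rewrite /i; field; rewrite tf0 five0.
    by rewrite -e mul0r sub0r.
  rewrite -iE chi_sqr //; apply: contra_eq_neq iE => ->.
  by rewrite expr0n eq_sym oppr_eq0 oner_eq0.
have N1_not : (-1 : 'F_v) \notin quartics 'F_v.
  by apply: N1_notin_quartics => //; rewrite cardF; move: v_mod16; clear; lia.
have [n chin] := exists_nonsquare two0.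
have step : quartic_diff (1 : 'F_v) = quartic_diff n + 1.
  have := quartic_diff_step two0 chiN1 N1_not (y := y) _ _ chin.
  by rewrite cardF; apply=> //; rewrite v_eq; ring.
have qdE (g : 'F_v) : g != 0 -> quartic_diff g = quartic_diff n + (quadratic_char g == 1)%:R.
  move=> g0; have [/chi_eq1[c c0 ->]|/(chi_eqN1 g0) chig] := eqVneq.
    by rewrite -(mul1r (c ^+ 2)) quartic_diff_sqr.
  have n0 : n != 0 by apply: contra_eq_neq chin => ->; rewrite chi0.
  (* A product of two nonsquares is a square, so g is n times a square. *)
  have /chi_eq1[c c0 cE] : quadratic_char (g * n) = 1 by rewrite chiM // chig chin.
  have -> : g = n * (c / n) ^+ 2 by rewrite expr_div_n -cE; field.
  by rewrite addr0 quartic_diff_sqr // mulf_neq0 ?invr_eq0.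
set H := nonzero_fourth_powers v; set D := _ - _.
have HE : quartics 'F_v = H by [].
have H0 : (0 : 'F_v) \notin H by rewrite !inE eqxx.
have DE (g : 'F_v) : D g = (g \in H)%:R - (g == 0)%:R by rewrite !ffunE in_set1.
have posE : gr_pos D = H.
  apply/setP=> g; rewrite inE DE; have [->|_] := eqVneq g 0.
    by rewrite (negPf H0).
  by rewrite subr0; case: (_ \in _).
have negE : gr_neg D = [set 0].
  apply/setP=> g; rewrite [LHS]inE DE in_set1; have [->|_] := eqVneq g 0.
    by rewrite (negPf H0).
  by rewrite subr0; case: (_ \in _).
(* For g nonzero the coefficient R(g) - [g is a square] is R(n), which is therefore lambda. *)
exists (#|H| + 1)%N, (quartic_diff n); split=> //.
- by move=> g; rewrite DE; case: (g \in H); case: (g == 0).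
- by rewrite posE negE cards1.
apply/ffunP=> g; rewrite [RHS]ffunE !gr_mulrzE !ffunE inE mul1r.
have delta (c : 'F_v) (f : 'F_v -> int) : \sum_h (h == c)%:R * f h = f c.
  rewrite (bigD1 c) //= eqxx mul1r big1 ?addr0 // => h /negPf->.
  by rewrite mul0r.
(* The product of H - [0] and its conjugate is expanded into four terms; the ones involving 0
   collapse by [delta]. *)
have -> : \sum_h D h * gr_conj D (h^-1 * g)%g =
    quartic_diff g - (g \in H)%:R - (- g \in H)%:R + (g == 0)%:R.
  have -> : quartic_diff g - (g \in H)%:R - (- g \in H)%:R + (g == 0)%:R =
      \sum_h ((h \in H)%:R * (h - g \in H)%:R - (h == g)%:R * (h \in H)%:R
        - (h == 0)%:R * (h - g \in H)%:R + (h == 0)%:R * (h == g)%:R).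
    rewrite big_split !sumrB /= (delta g (fun h => (h \in H)%:R)).
    rewrite (delta 0 (fun h => (h - g \in H)%:R)) (delta 0 (fun h => (h == g)%:R)).
    by rewrite sub0r [0 == g]eq_sym.
  apply: eq_bigr => h _.
  have -> : gr_conj D (h^-1 * g)%g = D (h - g).
    rewrite ffunE; congr (D _).
    by rewrite FinRing.zmodVgE FinRing.zmodMgE FinRing.zmodVgE opprD opprK.
  by rewrite !DE subr_eq0; ring.
rewrite FinRing.zmod1gE.
(* At 0 the coefficient is |H| + 1 = k = (k - lambda) + lambda; elsewhere the two membership terms
   add up to the indicator of squares. *)
have [->|g0] := eqVneq g 0.
  rewrite quartic_diff0 HE oppr0 (negPf H0) PoszD.
  by rewrite /= mulr1n mulr0n !subr0 mul1r subrK.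
rewrite qdE // -(quartic_or_opp two0 chiN1 N1_not g0) HE mulr0n mul0r; ring.
Qed.
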